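(* For every integer $k>3$, the number of minimal $(k,3)$-tricrucial permutations is $k-1$. For $k=3$, the number of minimal $(3,3)$-tricrucial permutations is $4$.
   Context: $i_m=12\cdots m$ and $d_m=m(m-1)\cdots 1$; a permutation (in one-line notation) contains $i_m$ (resp. $d_m$) if it has an increasing (resp. decreasing) subsequence of length $m$, and avoids it otherwise. For $1\le t\le n+1$ put $e_t(x)=x$ if $x<t$ and $e_t(x)=x+1$ if $x\ge t$. The extensions of a permutation $\sigma=\sigma_1\cdots\sigma_n$ of $\{1,\ldots,n\}$ ($n\ge1$) to the right are $e_t(\sigma_1)\cdots e_t(\sigma_n)\,t$, to the left are $t\,e_t(\sigma_1)\cdots e_t(\sigma_n)$, and from above are $\sigma_1\cdots\sigma_{t-1}(n+1)\sigma_t\cdots\sigma_n$, in each case for $1\le t\le n+1$. A permutation is $(k,\ell)$-tricrucial if it avoids $i_k$ and $d_\ell$ but each of its extensions to the right, to the left, and from above contains $i_k$ or $d_\ell$. Such a permutation is minimal if there is no $(k,\ell)$-tricrucial permutation (same $k,\ell$) of smaller length. *)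

(* Defs.v *)
From mathcomp Require Import all_boot all_fingroup.

Set Implicit Arguments.
Unset Strict Implicit.
Unset Printing Implicit Defensive.

(* One-line notation with letters 1, ..., n: the positions and values of
   s : 'S_n are numbered from 0, hence the successor. *)
Definition one_line (n : nat) (s : 'S_n) : seq nat :=
  [seq (s i : nat).+1 | i <- enum 'I_n].

Definition contains_inc (m : nat) (w : seq nat) : Prop :=
  exists u : seq nat, [/\ subseq u w, size u = m & sorted ltn u].

Definition contains_dec (m : nat) (w : seq nat) : Prop :=
  exists u : seq nat, [/\ subseq u w, size u = m & sorted gtn u].

(* bump t x is x if x < t and x.+1 if t <= x, i.e. e_t(x). *)
Definition ext_right (t : nat) (w : seq nat) : seq nat :=
  rcons [seq bump t x | x <- w] t.

Definition ext_left (t : nat) (w : seq nat) : seq nat :=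
  t :: [seq bump t x | x <- w].

(* Here t is the 1-based position of the new maximum. *)
Definition ext_above (t : nat) (w : seq nat) : seq nat :=
  take t.-1 w ++ (size w).+1 :: drop t.-1 w.

Definition tricrucial (k l n : nat) (s : 'S_n) : Prop :=
  let contains w := contains_inc k w \/ contains_dec l w in
  [/\ 0 < n,
      ~ contains_inc k (one_line s),
      ~ contains_dec l (one_line s) &
      forall t : nat, 1 <= t <= n.+1 ->
        [/\ contains (ext_right t (one_line s)),
            contains (ext_left t (one_line s)) &
            contains (ext_above t (one_line s))]].

Definition minimal_tricrucial (k l n : nat) (s : 'S_n) : Prop :=
  tricrucial k l s /\
  forall (m : nat) (r : 'S_m), m < n -> ~ tricrucial k l r.

(* Permutations of all lengths are collected in one type, so the count does
   not presuppose the minimal length. *)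
Definition num_minimal_tricrucial (k l N : nat) : Prop :=
  exists L : seq {n : nat & 'S_n},
    [/\ uniq L, size L = N &
        forall (n : nat) (s : 'S_n),
          Tagged (fun n : nat => 'S_n) s \in L <-> minimal_tricrucial k l s].

(* Main.v *)
Require Import Defs.
From mathcomp Require Import all_boot all_fingroup.
From mathcomp Require Import zify.

(** Write k = m + 1.

    An extension of w by a new last letter t creates a longer monotone
    subsequence only by appending t to an increasing subsequence of letters
    below t, or to a descent (two letters in decreasing order) among letters
    at least t. So the right extensions of an avoiding word w are all blocked
    iff for each t there is an increasing subsequence of size m below t, or a
    descent at or above t. The first condition is monotone in t, the second
    antitone, so all of them together amount to one crossing point: some t with
    m increasing letters <= t and a descent among letters >= t. Left extensions
    behave in the same way with the two sides exchanged, and extensions from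
    above with positions in place of values; this is [tricrucialE].

    The crossing point t on the right has m <= t and t + 1 <= n, since the
    descent needs two letters >= t; similarly the one on the left, t', has
    2 <= t' and t' + m <= n + 1. If n <= m + 1, then the letters 1, ..., m
    occur in increasing order while the left descent has to be 2 before 1,
    which is absurd ([stuck_length]). So n >= m + 2.

    Let n = m + 2 and m >= 3. The same clash of a long increasing run with the
    descent of the other side forces t = m + 1 and t' = 2 ([stuck_sides]): m + 2
    precedes m + 1, 2 precedes 1, and both increasing subsequences, each of
    which misses one letter of the other side's descent, must contain
    everything else, so that 2, 3, ..., m + 1 occur in this order. Avoidance of
    321 puts 1 before m + 1, so m + 1 is the last letter. The increasing
    subsequence given by the extensions from above avoids the last position; it
    can miss only one more letter, hence contains m and m + 2. Therefore the
    letters other than 1 read 2 3 ... m (m+2) (m+1), and 1 stands after 2 and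
    before m + 1. This leaves m = k - 1 words ([tricrucial_shape]); all of them
    are tricrucial ([word_tricrucial]).

    For m = 2 the increasing runs are too short for the clash. There the
    length is 4, only four words avoid both 123 and 321 ([avoiding3]), and each
    of these is tricrucial. *)

Set Implicit Arguments.
Unset Strict Implicit.
Unset Printing Implicit Defensive.

(** * Monotone subsequences and insertion of an extreme letter *)

(** Taking the order as a parameter treats increasing and decreasing
    subsequences together: contains ltn and contains gtn are convertible to
    contains_inc and contains_dec. *)
Definition contains (r : rel nat) (m : nat) (w : seq nat) : Prop :=
  exists u : seq nat, [/\ subseq u w, size u = m & sorted r u].

Lemma contains_sub r m v w : subseq v w -> contains r m v -> contains r m w.
Proof. by move=> vw [u [uv um us]]; exists u; split=> //; apply: subseq_trans vw. Qed.

Lemma contains_size r m w : contains r m w -> m <= size w.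
Proof. by case=> u [/size_subseq uw <- _]. Qed.

Lemma contains_map (r : rel nat) m f w :
  {mono f : x y / r x y} -> contains r m (map f w) <-> contains r m w.
Proof.
move=> fr; split=> [[u [/subseqP[b sb ->] um us]]|[u [uw um us]]].
  exists (mask b w); rewrite mask_subseq; split=> //.
    by rewrite -um -map_mask size_map.
  by move: us; rewrite -map_mask sorted_map (eq_sorted (e' := r)).
exists (map f u); rewrite map_subseq // size_map; split=> //.
by rewrite sorted_map (eq_sorted (e' := r)).
Qed.

Lemma subseq_cat_split (T : eqType) (u a b : seq T) :
  subseq u (a ++ b) ->
  exists u1 u2, [/\ u = u1 ++ u2, subseq u1 a & subseq u2 b].
Proof.
case/subseqP=> c sc ->; exists (mask (take (size a) c) a), (mask (drop (size a) c) b).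
rewrite !mask_subseq -mask_cat ?cat_take_drop //.
by rewrite size_takel // sc size_cat leq_addr.
Qed.

(** A chain through M has to end there, as nothing to the right of M is above
    it; otherwise the chain does not use M. *)
Lemma contains_insert_max (r : rel nat) m a M b :
  transitive r -> (forall x, x \in b -> ~~ r M x) ->
  contains r m.+1 (a ++ M :: b) <->
    contains r m.+1 (a ++ b) \/ contains r m [seq x <- a | r x M].
Proof.
move=> rT Mb; split=> [[u [uw um us]]|[]].
- case: (subseq_cat_split uw) => u1 [u2 [Eu u1a]].
  case: u2 Eu => [|y u2] Eu.
    move=> _; left; exists u; split=> //; rewrite Eu cats0.
    exact: subseq_trans u1a (prefix_subseq _ _).
  rewrite /=; case: eqP => [yM|_] u2b; last first.
    by left; exists u; split=> //; rewrite Eu cat_subseq.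
  right; subst y; have u20 : u2 = [::].
    case: u2 Eu u2b => // z u2 Eu u2b.
    have /Mb/negP[] : z \in b by apply: (mem_subseq u2b); rewrite inE eqxx.
    move: us; rewrite Eu.
    case: u1 {u1a Eu} => [|c u1] /=; first by case/andP.
    by rewrite cat_path /= => /and4P[].
  exists u1; move: um us; rewrite {}Eu {}u20 size_cat addn1 => -[um].
  rewrite cats1 sorted_pairwise // pairwise_rcons => /andP[u1M u1s].
  by rewrite subseq_filter u1M u1a sorted_pairwise.
- apply: contains_sub; exact: cat_subseq (subseq_refl _) (subseq_cons _ _).
- case=> u [uw um us]; exists (rcons u M); move: uw.
  rewrite subseq_filter size_rcons um => /andP[uM ua]; split=> //.
    by rewrite -cats1 cat_subseq // sub1seq inE eqxx.
  by rewrite sorted_pairwise // pairwise_rcons uM -sorted_pairwise.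
Qed.

(** Obtained from [contains_insert_max] by reading the word backwards with the
    converse order. *)
Lemma contains_insert_min (r : rel nat) m a M b :
  transitive r -> (forall x, x \in a -> ~~ r x M) ->
  contains r m.+1 (a ++ M :: b) <->
    contains r m.+1 (a ++ b) \/ contains r m [seq x <- b | r M x].
Proof.
have rev_contains r' n w :
    contains r' n w <-> contains (fun x y => r' y x) n (rev w).
  split=> -[u [uw un us]]; exists (rev u); rewrite size_rev; split=> //.
  - by rewrite subseq_rev.
  - by rewrite rev_sorted.
  - by rewrite -subseq_rev revK.
  - by rewrite rev_sorted.
move=> rT aM; rewrite [X in X <-> _]rev_contains [X in X \/ _]rev_contains.
rewrite [X in _ \/ X]rev_contains !rev_cat rev_cons -filter_rev cat_rcons.
apply: contains_insert_max => [y x z ryx rzy|x]; first exact: rT rzy ryx.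
by rewrite mem_rev; apply: aM.
Qed.

Lemma ltn_bump t : {mono bump t : x y / ltn x y}.
Proof. by move=> x y /=; rewrite /bump; lia. Qed.

Lemma gtn_bump t : {mono bump t : x y / gtn x y}.
Proof. by move=> x y /=; rewrite /bump; lia. Qed.

Lemma gtn_trans : transitive gtn.
Proof. by move=> y x z /=; lia. Qed.

(** The letters t and size w + 1 are extreme for their position in each of the
    extensions, so each extension is an instance of the two insertion lemmas. *)
Section Extensions.

Variables (m t : nat) (w : seq nat).

Lemma inc_ext_right :
  contains ltn m.+1 (ext_right t w) <->
  contains ltn m.+1 w \/ contains ltn m [seq x <- w | x < t].
Proof.
rewrite /ext_right -cats1 (contains_insert_max (r := ltn) _ _ ltn_trans) //.
rewrite cats0 filter_map !(contains_map _ _ (@ltn_bump t)).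
rewrite (eq_filter (a2 := fun x => x < t)) //.
by move=> x /=; rewrite /bump; lia.
Qed.

Lemma dec_ext_right :
  contains gtn m.+1 (ext_right t w) <->
  contains gtn m.+1 w \/ contains gtn m [seq x <- w | t <= x].
Proof.
rewrite /ext_right -cats1 (contains_insert_max (r := gtn) _ _ gtn_trans) //.
rewrite cats0 filter_map !(contains_map _ _ (@gtn_bump t)).
rewrite (eq_filter (a2 := fun x => t <= x)) //.
by move=> x /=; rewrite /bump; lia.
Qed.

Lemma inc_ext_left :
  contains ltn m.+1 (ext_left t w) <->
  contains ltn m.+1 w \/ contains ltn m [seq x <- w | t <= x].
Proof.
rewrite /ext_left -[_ :: _]cat0s.
rewrite (contains_insert_min (r := ltn) _ _ ltn_trans) //.
rewrite cat0s filter_map !(contains_map _ _ (@ltn_bump t)).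
rewrite (eq_filter (a2 := fun x => t <= x)) //.
by move=> x /=; rewrite /bump; lia.
Qed.

Lemma dec_ext_left :
  contains gtn m.+1 (ext_left t w) <->
  contains gtn m.+1 w \/ contains gtn m [seq x <- w | x < t].
Proof.
rewrite /ext_left -[_ :: _]cat0s.
rewrite (contains_insert_min (r := gtn) _ _ gtn_trans) //.
rewrite cat0s filter_map !(contains_map _ _ (@gtn_bump t)).
rewrite (eq_filter (a2 := fun x => x < t)) //.
by move=> x /=; rewrite /bump; lia.
Qed.

Hypothesis w_le : forall x, x \in w -> x <= size w.

Lemma inc_ext_above :
  contains ltn m.+1 (ext_above t w) <->
  contains ltn m.+1 w \/ contains ltn m (take t.-1 w).
Proof.
rewrite /ext_above (contains_insert_max (r := ltn) _ _ ltn_trans) => [|x /mem_drop/w_le].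
  rewrite cat_take_drop (@eq_in_filter _ _ predT) ?filter_predT // => x /mem_take/w_le.
  by rewrite /= ltnS.
by rewrite /=; lia.
Qed.

Lemma dec_ext_above :
  contains gtn m.+1 (ext_above t w) <->
  contains gtn m.+1 w \/ contains gtn m (drop t.-1 w).
Proof.
rewrite /ext_above (contains_insert_min (r := gtn) _ _ gtn_trans) => [|x /mem_take/w_le].
  rewrite cat_take_drop (@eq_in_filter _ _ predT) ?filter_predT // => x /mem_drop/w_le.
  by rewrite /= ltnS.
by rewrite /=; lia.
Qed.

End Extensions.

(** * Tricruciality as three crossing points *)

Lemma perm_one_line n (s : 'S_n) : perm_eq (one_line s) (iota 1 n).
Proof.
have -> : one_line s =
    [seq (i : nat).+1 | i : 'I_n <- [seq s j | j <- enum 'I_n]].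
  by rewrite -map_comp.
have -> : iota 1 n = [seq (i : nat).+1 | i : 'I_n <- enum 'I_n].
  by rewrite (map_comp succn) val_enum_ord -(iotaDl 1).
apply: perm_map; apply: uniq_perm => [||i]; rewrite ?enum_uniq //.
  by rewrite map_inj_uniq ?enum_uniq //; apply: perm_inj.
by rewrite mem_enum -(permKV s i) map_f ?mem_enum.
Qed.

(** Below the crossing point Q holds and above it P does; P and Q will be
    respectively monotone and antitone, so the conclusion implies the
    hypothesis again. *)
Lemma crossover (P Q : nat -> Prop) n :
  (forall t, 1 <= t <= n.+1 -> P t \/ Q t) -> ~ P 1 -> ~ Q n.+1 ->
  exists2 t, 1 <= t & P t.+1 /\ Q t.
Proof.
move=> PQ nP1 nQn.
suff: (exists2 t, 1 <= t & P t.+1 /\ Q t) \/ Q n.+1 by case.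
elim: n PQ {nQn} => [|n IHn] PQ; first by right; case: (PQ 1).
case: IHn => [t /andP[t0 tn]|E|Qn]; first by apply: PQ; rewrite t0 ltnW.
  by left.
by case: (PQ n.+2) => [|Pn|]; [rewrite ltnSn | left; exists n.+1 | right].
Qed.

(** The threshold t itself is allowed on both sides: it stands for the pair of
    consecutive extensions by t and t.+1, of which the first is blocked by the
    decreasing part and the second by the increasing part. On the left the
    roles of the parts are exchanged. *)
Definition stuck_right k l w :=
  exists t, contains ltn k [seq x <- w | x <= t] /\
            contains gtn l [seq x <- w | t <= x].

Definition stuck_left k l w :=
  exists t, contains ltn k [seq x <- w | t <= x] /\
            contains gtn l [seq x <- w | x <= t].

Definition stuck_above k l w :=
  exists p, contains ltn k (take p.+1 w) /\ contains gtn l (drop p w).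

Lemma filter_subpred (T : eqType) (a b : pred T) w :
  subpred a b -> subseq [seq x <- w | a x] [seq x <- w | b x].
Proof.
by move=> ab; rewrite subseq_filter filter_subseq andbT (sub_all ab) ?filter_all.
Qed.

Lemma not_contains0 r m w : 0 < m -> w =i [::] -> ~ contains r m w.
Proof.
case: w => [m0 _ /contains_size /=|x w _ w0]; first by rewrite leqNgt m0.
by have := w0 x; rewrite inE eqxx.
Qed.

Lemma take_subseq_take (T : eqType) i j (w : seq T) :
  i <= j -> subseq (take i w) (take j w).
Proof. by move=> ij; rewrite -(take_takel w ij) take_subseq. Qed.

Lemma drop_subseq_drop (T : eqType) i j (w : seq T) :
  j <= i -> subseq (drop i w) (drop j w).
Proof. by move=> ji; rewrite -(subnK ji) -drop_drop drop_subseq. Qed.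

(** [crossover] yields the thresholds; conversely, a value on either side of a
    threshold inherits the obstruction of that side by inclusion of
    subwords. *)
Lemma tricrucialE k l n (s : 'S_n) (w := one_line s) : 0 < k -> 0 < l ->
  tricrucial k.+1 l.+1 s <->
  [/\ ~ contains ltn k.+1 w, ~ contains gtn l.+1 w &
      [/\ stuck_right k l w, stuck_left k l w & stuck_above k l w]].
Proof.
move=> k0 l0; have wP := perm_one_line s; rewrite -/w in wP.
have wE x : (x \in w) = (1 <= x < 1 + n) by rewrite (perm_mem wP) mem_iota.
have ws : size w = n by rewrite (perm_size wP) size_iota.
have w_le x : x \in w -> x <= size w by rewrite wE ws; lia.
rewrite /tricrucial -/w; split=> [[n0 ninc ndec ext]|[ninc ndec [R L A]]].
  split=> //; split.
  - have [t||| t t0 [Pt Qt]] := @crossover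
        (fun t => contains ltn k [seq x <- w | x < t])
        (fun t => contains gtn l [seq x <- w | t <= x]) n; last by exists t.
    + by case/ext=> -[/inc_ext_right|/dec_ext_right] [] //; tauto.
    + by apply: not_contains0 => // x; rewrite mem_filter wE in_nil; lia.
    + by apply: not_contains0 => // x; rewrite mem_filter wE in_nil; lia.
  - have [t||| t t0 [Pt Qt]] := @crossover
        (fun t => contains gtn l [seq x <- w | x < t])
        (fun t => contains ltn k [seq x <- w | t <= x]) n; last by exists t.
    + by case/ext=> _ -[/inc_ext_left|/dec_ext_left] [] //; tauto.
    + by apply: not_contains0 => // x; rewrite mem_filter wE in_nil; lia.
    + by apply: not_contains0 => // x; rewrite mem_filter wE in_nil; lia.
  - have [t||| [//|p] _ [Pt Qt]] := @crossover
        (fun t => contains ltn k (take t.-1 w))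
        (fun t => contains gtn l (drop t.-1 w)) n; last by exists p.
    + case/ext=> _ _ [/(inc_ext_above _ _ w_le)|/(dec_ext_above _ _ w_le)] [] //;
        tauto.
    + by apply: not_contains0 => //; rewrite take0.
    + by apply: not_contains0 => //; rewrite drop_oversize ?ws.
split=> // [|t _].
  case: A => p [/contains_size + _]; rewrite size_take ws; case: ifP; lia.
split.
- case: R => u [uP uQ]; have [tu|ut] := leqP t u.
    right; apply/dec_ext_right; right; apply: contains_sub uQ.
    by apply: filter_subpred => x; apply: leq_trans.
  left; apply/inc_ext_right; right; apply: contains_sub uP.
  by apply: filter_subpred => x xu; apply: leq_ltn_trans ut.
- case: L => u [uP uQ]; have [tu|ut] := leqP t u.
    left; apply/inc_ext_left; right; apply: contains_sub uP.
    by apply: filter_subpred => x; apply: leq_trans.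
  right; apply/dec_ext_left; right; apply: contains_sub uQ.
  by apply: filter_subpred => x xu; apply: leq_ltn_trans ut.
- case: A => p [pP pQ]; have [tp|pt] := leqP t.-1 p.
    right; apply/dec_ext_above => //; right; apply: contains_sub pQ.
    exact: drop_subseq_drop.
  left; apply/inc_ext_above => //; right; apply: contains_sub pP.
  exact: take_subseq_take.
Qed.

(** * Order of letters and counting *)

Definition before (w : seq nat) : rel nat := relpre (index^~ w) ltn.

Lemma before_trans w : transitive (before w).
Proof. by move=> y x z; apply: ltn_trans. Qed.

Lemma sorted_before u w : uniq w -> subseq u w -> sorted (before w) u.
Proof.
move=> wU uw; apply: (subseq_sorted (@before_trans w) uw).
apply/(sortedP 0) => i iw; rewrite /before /= !index_uniq //.
exact: ltn_trans (ltnSn i) iw.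
Qed.

(** This turns subwords into statements about pairs of letters, which are easier
    to combine. *)
Lemma increasing_before u w x y : uniq w -> subseq u w -> sorted ltn u ->
  x \in u -> y \in u -> x < y -> before w x y.
Proof.
move=> wU uw us xu yu xy; have uB := sorted_before wU uw.
apply: (sorted_ltn_index (@before_trans w) uB) => //.
rewrite ltnNge; apply/negP => yx.
have uL : sorted leq u by apply: sub_sorted us => ? ?; apply: ltnW.
by have := sorted_leq_index leq_trans leqnn uL _ _ yu xu yx; rewrite leqNgt xy.
Qed.

Lemma before_subseq u w : uniq w -> {subset u <= w} -> sorted (before w) u ->
  subseq u w.
Proof.
move=> wU uw us; suff -> : u = [seq x <- w | x \in u] by apply: filter_subseq.
apply: (irr_sorted_eq (@before_trans w)) => //.
- by move=> x; rewrite /before /= ltnn.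
- exact: sorted_before (filter_subseq _ _).
- by move=> x; rewrite mem_filter; case: (boolP (x \in u)) => [/uw->|].
Qed.

Lemma contains_filterE r m D w : contains r m [seq x <- w | D x] ->
  exists u, [/\ subseq u w, size u = m, sorted r u & all D u].
Proof.
by case=> u []; rewrite subseq_filter => /andP[Du uw] um us; exists u.
Qed.

Lemma contains_descent D w : uniq w -> contains gtn 2 [seq x <- w | D x] ->
  exists x y, [/\ x \in w, y \in w, before w x y, y < x & D x && D y].
Proof.
move=> wU /contains_filterE[[|x [|y [|z u]]] [xyw // _]] /=; rewrite !andbT => yx Dxy.
exists x, y; split=> //; rewrite ?(mem_subseq xyw) ?inE ?eqxx ?orbT //.
by have := sorted_before wU xyw; rewrite /= andbT.
Qed.

Lemma before_asym w x y : before w x y -> before w y x = false.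
Proof. by rewrite /before /= => xy; rewrite ltnNge ltnW. Qed.

(** Hypotheses about sequences would be translated to booleans by the
    arithmetic solver and make it split cases needlessly. *)
Ltac arith :=
  repeat match goal with
  | H : is_true (subseq _ _) |- _ => clear H
  | H : is_true (sorted _ _) |- _ => clear H
  | H : is_true (uniq _) |- _ => clear H
  | H : is_true (perm_eq _ _) |- _ => clear H
  | H : is_true (before _ _ _) |- _ => clear H
  | H : is_true (_ \in _) |- _ => clear H
  | H : is_true (_ \notin _) |- _ => clear H
  | H : contains _ _ _ |- _ => clear H
  | H : ~ contains _ _ _ |- _ => clear H
  | H : forall x, _ |- _ => clear H
  | H : {subset _ <= _} |- _ => clear H
  end; lia.

(** Pigeonhole: u and v would otherwise be disjoint inside s. *)
Lemma increasing_meets (s u v : seq nat) : sorted ltn u -> {subset u <= s} ->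
  uniq v -> {subset v <= s} -> size s < size v + size u -> has (mem u) v.
Proof.
move=> us uS vU vS; apply: contraTT => vu.
rewrite -leqNgt -size_cat; apply: uniq_leq_size.
  by rewrite cat_uniq vU has_sym vu (sorted_uniq ltn_trans ltnn us).
by move=> x; rewrite mem_cat => /orP[/vS|/uS].
Qed.

Lemma increasing_full (s u : seq nat) x : sorted ltn u -> {subset u <= s} ->
  size s <= size u -> x \in s -> x \in u.
Proof.
move=> us uS su xs; have := @increasing_meets s u [:: x] us uS isT.
by rewrite /= orbF; apply => // z; rewrite inE => /eqP->.
Qed.

(** An increasing subsequence misses a letter of every descent. If it misses at
    most one letter of s, it contains all the others. *)
Lemma descent_forces w (s u : seq nat) x y z : uniq w -> subseq u w ->
  sorted ltn u -> {subset u <= s} -> size s <= (size u).+1 ->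
  before w x y -> y < x -> x \in s -> y \in s ->
  z \in s -> z != x -> z != y -> z \in u.
Proof.
move=> wU uw us uS su xy yx xs ys zs zx zy; apply/idPn => zu.
have meet a : a \in s -> z != a -> a \in u.
  move=> aS za; have := @increasing_meets s u [:: z; a] us uS.
  rewrite /= (negPf zu) orbF inE za; apply=> // b.
  by rewrite !inE => /orP[] /eqP->.
have := increasing_before wU uw us (meet y ys zy) (meet x xs zx) yx.
by rewrite (before_asym xy).
Qed.

Lemma size_increasing (s u : seq nat) :
  sorted ltn u -> {subset u <= s} -> size u <= size s.
Proof. by move=> /(sorted_uniq ltn_trans ltnn) uU uS; apply: uniq_leq_size. Qed.

(** * The length is at least k + 1 *)

Section Word.

Variables (m n : nat) (w : seq nat).
Hypothesis wP : perm_eq w (iota 1 n).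

Let wU : uniq w. Proof. by rewrite (perm_uniq wP) iota_uniq. Qed.

Let wE x : (x \in w) = (1 <= x <= n).
Proof. by rewrite (perm_mem wP) mem_iota; lia. Qed.

Lemma stuck_rightE : stuck_right m 2 w -> exists t u x y,
  [/\ [/\ subseq u w, size u = m, sorted ltn u & {subset u <= iota 1 t}],
      before w x y, t <= y < x, x <= n & m <= t].
Proof.
case=> t [/contains_filterE[u [uw um us /allP ut]]].
case/(contains_descent wU) => x [y [xw yw xy yx /andP[tx ty]]].
have uS : {subset u <= iota 1 t}.
  move=> z zu; have := mem_subseq uw zu; have := ut z zu.
  by rewrite wE mem_iota; arith.
exists t, u, x, y; split=> //; first by rewrite ty.
  by move: xw; rewrite wE => /andP[].
by have := size_increasing us uS; rewrite um size_iota.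
Qed.

Lemma stuck_leftE : stuck_left m 2 w -> exists t u x y,
  [/\ [/\ subseq u w, size u = m, sorted ltn u & {subset u <= iota t (n.+1 - t)}],
      before w x y, y < x <= t, 1 <= y & m <= n.+1 - t].
Proof.
case=> t [/contains_filterE[u [uw um us /allP ut]]].
case/(contains_descent wU) => x [y [xw yw xy yx /andP[tx ty]]].
have uS : {subset u <= iota t (n.+1 - t)}.
  move=> z zu; have := mem_subseq uw zu; have := ut z zu.
  by rewrite wE mem_iota; arith.
exists t, u, x, y; split=> //; first by rewrite yx.
  by move: yw; rewrite wE => /andP[].
by have := size_increasing us uS; rewrite um size_iota.
Qed.

(** Otherwise the right threshold is at most m, so that 1 and 2 occur in
    increasing order, while the left threshold is 2 and needs 2 before 1. *)
Lemma stuck_length : 1 < m -> stuck_right m 2 w -> stuck_left m 2 w -> m.+1 < n.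
Proof.
move=> m1 /stuck_rightE[t [u [x [y [[uw um us ut] _ tyx xn mt]]]]].
case/stuck_leftE=> t' [_ [x' [y' [_ xy' yxt y1 mt']]]].
rewrite ltnNge; apply/negP => nm.
have [x2 y2] : x' = 2 /\ y' = 1 by arith.
have tm : t <= m by arith.
have u_mem z : z \in [:: 1; 2] -> z \in u.
  move=> z12; apply: (increasing_full us ut); first by rewrite size_iota um.
  by rewrite mem_iota; move: z12; rewrite !inE; arith.
have := increasing_before wU uw us (u_mem 1 isT) (u_mem 2 isT) isT.
by rewrite -x2 -y2 (before_asym xy').
Qed.

End Word.

(** * The words of length k + 1 for k > 3 *)

Section Shortest.

Variables (m : nat) (w : seq nat).
Hypothesis wP : perm_eq w (iota 1 m.+2).

Let wU : uniq w. Proof. by rewrite (perm_uniq wP) iota_uniq. Qed.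

Let wE x : (x \in w) = (1 <= x <= m.+2).
Proof. by rewrite (perm_mem wP) mem_iota; lia. Qed.

(** A right threshold t <= m would put 1, ..., m in increasing order, which
    contradicts the left descent: its letters are at most 3 <= m. Dually on the
    left. For k = 3 the runs are too short for these clashes. *)
Lemma stuck_sides : 2 < m -> stuck_right m 2 w -> stuck_left m 2 w ->
  [/\ before w m.+2 m.+1, before w 2 1 &
      forall a b, 2 <= a -> a < b -> b <= m.+1 -> before w a b].
Proof.
move=> m2 /(stuck_rightE wP)[t [u [x [y [[uw um us ut] xy tyx xn mt]]]]].
case/(stuck_leftE wP)=> t' [u' [x' [y' [[uw' um' us' ut'] xy' yxt y1 mt']]]].
have tE : t = m.+1.
  have [//|tm] := eqVneq t m.+1; have {tm}tm : t <= m by arith.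
  have u_mem z : 1 <= z <= m -> z \in u.
    move=> zm; apply: (increasing_full us ut); rewrite ?size_iota ?um //.
    by rewrite mem_iota; arith.
  have y_x : y' < x' by arith.
  have := increasing_before wU uw us (u_mem y' _) (u_mem x' _) y_x.
  by rewrite (before_asym xy') => H; have : false by apply: H; arith.
have tE' : t' = 2.
  have [//|tm] := eqVneq t' 2; have {tm}tm : 3 <= t' by arith.
  have u_mem z : 3 <= z <= m.+2 -> z \in u'.
    move=> zm; apply: (increasing_full us' ut'); rewrite ?size_iota ?um'; first by arith.
    by rewrite mem_iota; arith.
  have y_x : y < x by arith.
  have := increasing_before wU uw' us' (u_mem y _) (u_mem x _) y_x.
  by rewrite (before_asym xy) => H; have : false by apply: H; arith.
have [Ex Ey] : x = m.+2 /\ y = m.+1 by arith.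
have [Ex' Ey'] : x' = 2 /\ y' = 1 by arith.
subst t t' x y x' y'; split=> //.
have mem_u z : 3 <= z <= m.+1 -> z \in u.
  by move=> zm; apply: (descent_forces wU uw us ut _ xy');
     rewrite ?size_iota ?um ?mem_iota //; arith.
have mem_u' z : 2 <= z <= m -> z \in u'.
  by move=> zm; apply: (descent_forces wU uw' us' ut' _ xy);
     rewrite ?size_iota ?um' ?mem_iota //; arith.
(* u contains 3, ..., m.+1 and u' contains 2, ..., m; both contain 3 as 3 <= m,
   so 3 serves as the link when a = 2 and b = m.+1. *)
move=> a b a2 ab bm.
have [a3|a3] := ltnP 2 a.
  by apply: (increasing_before wU uw us) => //; apply: mem_u; arith.
have [bm'|bm'] := leqP b m.
  by apply: (increasing_before wU uw' us') => //; apply: mem_u'; arith.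
apply: (@before_trans w 3).
  by apply: (increasing_before wU uw' us'); rewrite ?mem_u' //; arith.
by apply: (increasing_before wU uw us); rewrite ?mem_u //; arith.
Qed.

(** If 1 came after m.+1, then m.+2, m.+1, 1 would be a decreasing
    subsequence. *)
Lemma all_before_last : 0 < m -> ~ contains gtn 3 w ->
  before w m.+2 m.+1 -> before w 2 1 ->
  (forall a b, 2 <= a -> a < b -> b <= m.+1 -> before w a b) ->
  forall a, a \in w -> a != m.+1 -> before w a m.+1.
Proof.
move=> m0 ndec b_top b_bot chain a; rewrite wE => am anm.
have [a1|a1] := ltnP 1 a.
  have [->|atop] := eqVneq a m.+2; first exact: b_top.
  by apply: chain; arith.
have {a1}-> : a = 1 by arith.
rewrite /before /= ltnNge leq_eqVlt; apply/norP; split.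
  apply/eqP => /(congr1 (nth 0 w)); rewrite !nth_index ?wE //; arith.
apply/negP => k1; apply: ndec; exists [:: m.+2; m.+1; 1]; split=> //=; last by arith.
apply: before_subseq => [//|z|]; first by rewrite !inE wE; arith.
by apply/and3P; split.
Qed.

(** The increasing subsequence lies in take p.+1 w with p <= m, so it does not
    reach m.+1, the last letter. It thus misses m.+1 and one of 2 and 1, and
    having size m it contains m and m.+2. *)
Lemma before_max :
  (forall a, a \in w -> a != m.+1 -> before w a m.+1) -> before w 2 1 ->
  2 < m -> stuck_above m 2 w -> before w m m.+2.
Proof.
move=> last_w b_bot m2 [p [[v [vp vm vs]] /contains_size]].
rewrite size_drop (perm_size wP) size_iota => pm.
have vw : subseq v w := subseq_trans vp (take_subseq _ _).
(* All other m.+1 letters come before m.+1. *)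
have m_idx : m < index m.+1 w.
  suff : size (rem m.+1 (iota 1 m.+2)) <= size (take (index m.+1 w) w).
    by rewrite size_rem ?size_iota ?size_takel ?index_size // mem_iota; arith.
  apply: uniq_leq_size; first by rewrite rem_uniq ?iota_uniq.
  move=> a; rewrite mem_rem_uniq ?iota_uniq // !inE mem_iota => /andP[anm am].
  have aw : a \in w by rewrite wE; arith.
  by rewrite in_take //; apply: last_w.
have vS : {subset v <= rem m.+1 (iota 1 m.+2)}.
  move=> a av; rewrite mem_rem_uniq ?iota_uniq // !inE mem_iota.
  have := mem_subseq vw av; rewrite wE => aw; apply/andP; split; last by arith.
  apply/eqP => ak; have := mem_subseq vp av; rewrite ak in_take ?wE; arith.
have mem_v a : a \in [:: m; m.+2] -> a \in v.
  rewrite !inE => am; have sz : size (rem m.+1 (iota 1 m.+2)) <= (size v).+1.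
    by rewrite size_rem ?size_iota ?vm // mem_iota; arith.
  apply: (descent_forces wU vw vs vS sz b_bot) => //;
    by rewrite ?mem_rem_uniq ?iota_uniq // ?inE ?mem_iota; arith.
by apply: (increasing_before wU vw vs); rewrite ?mem_v ?inE ?eqxx ?orbT.
Qed.

End Shortest.

(** The letters other than 1, in the only order they can have. *)
Definition core m := iota 2 m.-1 ++ [:: m.+2; m.+1].

(** Both ends are excluded for j by the descent 2, 1 and by the last letter, so
    j runs over the m values 1, ..., m. *)
Definition word m j := take j (core m) ++ 1 :: drop j (core m).

Lemma size_core m : 0 < m -> size (core m) = m.+1.
Proof. by move=> m0; rewrite size_cat size_iota /=; lia. Qed.

Lemma mem_core m x : 0 < m -> (x \in core m) = (2 <= x <= m.+2).
Proof. by move=> m0; rewrite mem_cat mem_iota !inE; lia. Qed.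

Lemma path_iota (r : rel nat) a n :
  (forall i, a <= i < a + n -> r i i.+1) -> path r a (iota a.+1 n).
Proof.
elim: n a => //= n IHn a ra; rewrite ra ?IHn //; last lia.
by move=> i ia; apply: ra; lia.
Qed.

Lemma last_iota a n : last a (iota a.+1 n) = a + n.
Proof. by elim: n a => [|n IHn] a /=; rewrite ?addn0 // IHn addSnnS. Qed.

(** Deleting 1 leaves the core, as both are sorted by position in w. *)
Lemma tricrucial_shape m w : 2 < m -> perm_eq w (iota 1 m.+2) -> ~ contains gtn 3 w ->
  stuck_right m 2 w -> stuck_left m 2 w -> stuck_above m 2 w ->
  exists2 j, 1 <= j <= m & w = word m j.
Proof.
move=> m2 wP ndec R L A.
have wU : uniq w by rewrite (perm_uniq wP) iota_uniq.
have wE x : (x \in w) = (1 <= x <= m.+2) by rewrite (perm_mem wP) mem_iota; lia.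
have [b_top b_bot chain] := stuck_sides wP m2 R L.
have last_w := all_before_last wP (ltnW (ltnW m2)) ndec b_top b_bot chain.
have b_m := before_max wP last_w b_bot m2 A.
have core_s : sorted (before w) (core m).
  have [d Em] : exists d, m = d.+2 by exists m.-2; arith.
  have last_d : last 2 (iota 3 d) = m.
    by rewrite last_iota Em.
  rewrite /core {1}Em /= cat_path /= last_d b_top b_m !andbT.
  by apply: path_iota => i im; apply: chain; arith.
have coreE : core m = [seq x <- w | x != 1].
  apply: (irr_sorted_eq (@before_trans w)) core_s _ _ => [a||a].
  - by rewrite /before /= ltnn.
  - exact: sorted_before (filter_subseq _ _).
  - by rewrite mem_filter wE mem_core; arith.
have w1 : 1 \in w by rewrite wE.
have b_1 : before w 1 m.+1 by apply: (last_w 1 w1); arith.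
have [l1 [l2 Ew]] : exists w1 l2, w = w1 ++ 1 :: l2.
  by case/splitPr: w1 => l1 l2; exists l1, l2.
have [n1 n2] : 1 \notin l1 /\ 1 \notin l2.
  by move: wU; rewrite Ew uniq_catC /= mem_cat negb_or => /andP[/andP[]].
have {}coreE : core m = l1 ++ l2.
  rewrite coreE Ew filter_cat /=; congr (_ ++ _); apply/all_filterP/allP => a.
    by move=> aw; apply: contraNneq n1 => <-.
  by move=> aw; apply: contraNneq n2 => <-.
exists (size l1); last by rewrite Ew /word coreE take_size_cat // drop_size_cat.
have i1 : index 1 w = size l1 by rewrite Ew index_cat (negPf n1) /= addn0.
have := size_core (ltnW (ltnW m2)); rewrite coreE size_cat => sz.
apply/andP; split; first by move: b_bot; rewrite /before /= i1; case: (size l1).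
have : m.+1 \in l1 ++ l2 by rewrite -coreE mem_core; arith.
rewrite mem_cat => /orP[k1|]; last by case: l2 sz {Ew n2 coreE} => //= ? ?; arith.
have := b_1; rewrite /before /= i1 Ew index_cat k1 => lt1.
by have := index_size m.+1 l1; rewrite leqNgt lt1.
Qed.

(** * Converse: the words are tricrucial *)

Lemma word_perm m j : 0 < m -> perm_eq (word m j) (iota 1 m.+2).
Proof.
move=> m0; have cU : uniq (core m).
  by rewrite cat_uniq iota_uniq /= !inE !mem_iota; lia.
rewrite /word -cat1s perm_catCA cat_take_drop cat1s.
apply: uniq_perm => [||x]; first by rewrite cons_uniq cU mem_core.
  exact: iota_uniq.
by rewrite inE mem_core // mem_iota; lia.
Qed.

Lemma core_subseq m j : subseq (core m) (word m j).
Proof.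
by rewrite -{1}(cat_take_drop j (core m)) cat_subseq // subseq_cons.
Qed.

(** Cutting w at the place where the pivot x is matched produces the threshold
    for extensions from above: one part of the pattern ends at x, the other
    starts there. *)
Lemma subseq_pivot (u1 u2 w : seq nat) x : subseq (u1 ++ x :: u2) w ->
  exists p, subseq (rcons u1 x) (take p.+1 w) /\ subseq (x :: u2) (drop p w).
Proof.
elim: w u1 => [|y w IHw] u1; first by case: u1.
have shift u1' : subseq (u1' ++ x :: u2) w -> exists p,
    subseq (rcons u1' x) (take p.+2 (y :: w)) /\ subseq (x :: u2) (drop p.+1 (y :: w)).
  case/IHw=> p [pa pb]; exists p; split=> //.
  exact: subseq_trans pa (subseq_cons _ _).
case: u1 => [|z u1].
  have [<- uw|yx uw] := eqVneq x y.
    by exists 0; split; [rewrite /= eqxx sub0seq | rewrite drop0].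
  case: (shift [::]) => [|p ?]; last by exists p.+1.
  by move: uw; rewrite /= (negPf yx).
have [<- uw|yz uw] := eqVneq z y.
  case: (IHw u1) => [|p [pa pb]]; first by move: uw; rewrite /= eqxx.
  by exists p.+1; split=> //=; rewrite eqxx.
case: (shift (z :: u1)) => [|p ?]; last by exists p.+1.
by move: uw; rewrite /= (negPf yz).
Qed.

Lemma contains_filterI r m D u w : subseq u w -> size u = m -> sorted r u ->
  all D u -> contains r m [seq x <- w | D x].
Proof. by move=> uw um us Du; exists u; rewrite subseq_filter Du. Qed.

(** An increasing subsequence misses one letter of each of two disjoint
    descents. *)
Lemma no_long_increasing m w a b c d : perm_eq w (iota 1 m.+2) ->
  before w a b -> b < a -> before w c d -> d < c -> uniq [:: a; b; c; d] ->
  {subset [:: a; b; c; d] <= w} -> ~ contains ltn m.+1 w.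
Proof.
move=> wP ab ba cd dc U S [u [uw um us]].
have wU : uniq w by rewrite (perm_uniq wP) iota_uniq.
have uS := mem_subseq uw.
have miss x y : before w x y -> y < x -> exists2 z, z \in [:: x; y] & z \notin u.
  move=> xy yx; have [xu|xu] := boolP (x \in u); last by exists x; rewrite ?inE ?eqxx.
  have [yu|yu] := boolP (y \in u); last by exists y; rewrite ?inE ?eqxx ?orbT.
  by have := increasing_before wU uw us yu xu yx; rewrite (before_asym xy).
have [z zab zu] := miss a b ab ba; have [t tcd tu] := miss c d cd dc.
have zt : z != t.
  apply/eqP => E; subst t; move: U.
  by rewrite -[_ :: _]/([:: a; b] ++ [:: c; d]) cat_uniq => /and3P[_ /hasP[]]; exists z.
have zS x : x \in [:: z; t] -> x \in w.
  rewrite !inE => /orP[] /eqP->; apply: S.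
    by move: zab; rewrite !inE => /orP[->|->]; rewrite ?orbT.
  by move: tcd; rewrite !inE => /orP[->|->]; rewrite ?orbT.
have := @increasing_meets w u [:: z; t] us uS.
rewrite /= (negPf zu) (negPf tu) (perm_size wP) size_iota um inE zt.
by move=> H; have : false by apply: H.
Qed.

Lemma increasing_no_descent m w : sorted ltn w -> ~ contains gtn m.+2 w.
Proof.
move=> ws [[|x [|y u]] [// uw _ /= /andP[yx _]]].
have /= /andP[xy _] := subseq_sorted ltn_trans uw ws.
by have := ltn_trans xy yx; rewrite ltnn.
Qed.

(** The core without its last letter is increasing. *)
Definition ramp m := rcons (iota 2 m.-1) m.+2.

Lemma coreE m : core m = ramp m ++ [:: m.+1].
Proof. by rewrite /core /ramp cat_rcons. Qed.

Lemma size_ramp m : 0 < m -> size (ramp m) = m.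
Proof. by rewrite size_rcons size_iota => /prednK. Qed.

Lemma ramp_sorted m : sorted ltn (ramp m).
Proof.
rewrite (sorted_pairwise ltn_trans) pairwise_rcons.
rewrite -(sorted_pairwise ltn_trans) iota_ltn_sorted andbT.
by apply/allP => x; rewrite mem_iota /=; lia.
Qed.

(** A decreasing triple without 1 lies in the core, so two of its letters lie in
    the increasing ramp. One with 1 ends there, so its other two letters lie in
    the part of the core before 1, which is again increasing. *)
Lemma word_no_decreasing m j : 0 < m -> j <= m -> ~ contains gtn 3 (word m j).
Proof.
move=> m0 jm; rewrite /word (contains_insert_max _ _ gtn_trans); last first.
  by move=> x /mem_drop; rewrite mem_core //=; lia.
rewrite cat_take_drop coreE (contains_insert_max _ _ gtn_trans) //.
rewrite cats0 takel_cat ?size_ramp //.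
case=> [[]|]; first exact: increasing_no_descent (ramp_sorted m).
  by apply: increasing_no_descent; apply: sorted_filter (ramp_sorted m); apply: ltn_trans.
apply: increasing_no_descent; apply: sorted_filter; first exact: ltn_trans.
exact: take_sorted (ramp_sorted m).
Qed.

Lemma word_tricrucial m j n (s : 'S_n) : 1 < m -> 1 <= j <= m ->
  one_line s = word m j -> tricrucial m.+1 3 s.
Proof.
move=> m1 /andP[j1 jm] sE; have m0 : 0 < m := ltnW m1.
apply/tricrucialE => //; rewrite sE.
have wP := word_perm j m0.
have wU : uniq (word m j) by rewrite (perm_uniq wP) iota_uniq.
have cw := core_subseq m j.
have top_desc : subseq [:: m.+2; m.+1] (word m j).
  exact: subseq_trans (suffix_subseq _ _) cw.
have bot_desc : subseq [:: 2; 1] (word m j).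
  apply: (@cat_subseq _ [:: 2] [:: 1]); rewrite sub1seq ?mem_head //.
  by rewrite /core; case: m j m1 j1 {jm wP wU cw m0 sE top_desc} => [|[|m]] [|j].
have inc_w : subseq (iota 2 m) (word m j).
  apply: subseq_trans cw; rewrite -{1}(prednK m0) -[m.-1.+1]addn1 iotaD cat_subseq //.
  by rewrite sub1seq !inE; lia.
split; last split.
- have b_top : before (word m j) m.+2 m.+1.
    by have /andP[] := sorted_before wU top_desc.
  have b_bot : before (word m j) 2 1.
    by have /andP[] := sorted_before wU bot_desc.
  apply: (no_long_increasing wP b_top _ b_bot) => //.
    by rewrite /= !inE; lia.
  by move=> x; rewrite (perm_mem wP) mem_iota !inE; lia.
- exact: word_no_decreasing.
- exists m.+1; split.
    apply: contains_filterI inc_w _ _ _; rewrite ?size_iota ?iota_ltn_sorted //.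
    by apply/allP => x; rewrite mem_iota; lia.
  by apply: contains_filterI top_desc _ _ _ => //=; rewrite ?ltnSn ?leqnn ?leqnSn.
- exists 2; split.
    apply: contains_filterI inc_w _ _ _; rewrite ?size_iota ?iota_ltn_sorted //.
    by apply/allP => x; rewrite mem_iota; lia.
  exact: contains_filterI bot_desc _ _ _.
- have [p [pa pb]] := subseq_pivot cw; exists p; split.
    by exists (ramp m); rewrite size_ramp ?ramp_sorted.
  by exists [:: m.+2; m.+1]; split=> //=; rewrite ltnSn.
Qed.

(** * Counting *)

Lemma one_line_of_word n w : perm_eq w (iota 1 n) ->
  exists s : 'S_n, one_line s = w.
Proof.
move=> wP; have sw : size w = n by rewrite (perm_size wP) size_iota.
have wU : uniq w by rewrite (perm_uniq wP) iota_uniq.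
have w_range (i : 'I_n) : 1 <= nth 0 w i <= n.
  have : nth 0 w i \in w by rewrite mem_nth ?sw.
  by rewrite (perm_mem wP) mem_iota add1n ltnS.
have lt_f (i : 'I_n) : (nth 0 w i).-1 < n.
  by have /andP[w0 wn] := w_range i; rewrite prednK.
have inj_f : injective (fun i => Ordinal (lt_f i)).
  move=> i j [] /(congr1 succn); rewrite !prednK; first last.
  - by case/andP: (w_range i).
  - by case/andP: (w_range j).
  by move=> /eqP; rewrite nth_uniq ?sw // => /eqP; apply: ord_inj.
exists (perm inj_f); apply: (@eq_from_nth _ 0) => [|i].
  by rewrite size_map size_enum_ord.
rewrite size_map size_enum_ord => i_n.
rewrite (nth_map (Ordinal i_n)) ?size_enum_ord // permE /=.
have -> : nth (Ordinal i_n) (enum 'I_n) i = Ordinal i_n.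
  by apply: ord_inj; rewrite nth_enum_ord.
by rewrite prednK //; case/andP: (w_range (Ordinal i_n)).
Qed.

Lemma one_line_inj n : injective (@one_line n).
Proof.
move=> s r /eq_in_map sr; apply/permP => i; apply: ord_inj.
by apply: succn_inj; apply: sr; rewrite mem_enum.
Qed.

Lemma tagged_one_line_inj :
  injective (fun x : {n : nat & 'S_n} => one_line (tagged x)).
Proof.
move=> [n s] [n' r] /= sr.
have En : n = n'.
  by move/(congr1 size): sr; rewrite !(perm_size (perm_one_line _)) !size_iota.
by subst n'; rewrite (one_line_inj sr).
Qed.

(** Minimal permutations can be counted as words, since one-line notation is
    injective across all lengths at once. *)
Lemma num_minimal_words k l (ws : seq (seq nat)) : uniq ws ->
  {in ws, forall w, perm_eq w (iota 1 (size w))} ->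
  (forall n (s : 'S_n), minimal_tricrucial k l s <-> one_line s \in ws) ->
  num_minimal_tricrucial k l (size ws).
Proof.
move=> wsU wsP min_ws.
have [L LE] : exists L : seq {n : nat & 'S_n},
    [seq one_line (tagged x) | x <- L] = ws.
  elim: ws wsP {wsU min_ws} => [|w ws IHws] wsP; first by exists [::].
  have [L <-] := IHws (fun v vs => wsP v (mem_behead (s := w :: ws) vs)).
  have [s sw] := one_line_of_word (wsP w (mem_head _ _)).
  by exists (Tagged (fun n => 'S_n) s :: L); rewrite /= sw.
exists L; split.
- by apply: (@map_uniq _ _ (fun x => one_line (tagged x))); rewrite LE.
- by rewrite -LE size_map.
- move=> n s; rewrite min_ws -LE.
  by rewrite -(mem_map tagged_one_line_inj L (Tagged (fun n => 'S_n) s)).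
Qed.

(** word m 1 shows that the lower bound m.+2 on the length is attained. *)
Lemma minimal_tricrucialE m n (s : 'S_n) : 1 < m ->
  minimal_tricrucial m.+1 3 s <-> tricrucial m.+1 3 s /\ n = m.+2.
Proof.
move=> m1; have m0 := ltnW m1.
have long n' (r : 'S_n') : tricrucial m.+1 3 r -> m.+1 < n'.
  case/(tricrucialE (l := 2) _ m0 isT)=> _ _ [R L _].
  exact: stuck_length (perm_one_line r) m1 R L.
split=> [[tri min]|[tri En]]; last by split=> // n' r n'm /long; lia.
split=> //; apply/eqP; rewrite eqn_leq (long _ s tri) andbT leqNgt; apply/negP => mn.
have [s0 s0E] := one_line_of_word (word_perm 1 m0).
by apply: (min _ s0 mn); apply: word_tricrucial s0E.
Qed.

Lemma word_inj m : 0 < m -> {in iota 1 m &, injective (word m)}.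
Proof.
move=> m0 i j; rewrite !mem_iota => im jm /(congr1 (index 1)).
have idx t : 1 <= t < 1 + m -> index 1 (word m t) = t.
  move=> tm; rewrite index_cat ifN /=; last first.
    by apply/negP => /mem_take; rewrite mem_core.
  by rewrite addn0 size_takel // size_core //; lia.
by rewrite !idx.
Qed.

Lemma uniq_words m : 0 < m -> uniq [seq word m j | j <- iota 1 m].
Proof. by move=> m0; rewrite map_inj_in_uniq ?iota_uniq //; apply: word_inj. Qed.

Lemma words_perm_iota m : 0 < m ->
  {in [seq word m j | j <- iota 1 m], forall w, perm_eq w (iota 1 (size w))}.
Proof.
move=> m0 w /mapP[j _ ->]; have wP := word_perm j m0.
by rewrite (perm_size wP) size_iota.
Qed.

Lemma minimal_tricrucial_gt3 m n (s : 'S_n) : 2 < m ->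
  minimal_tricrucial m.+1 3 s <-> one_line s \in [seq word m j | j <- iota 1 m].
Proof.
move=> m2; have m0 : 0 < m by lia.
rewrite minimal_tricrucialE; last by lia.
split=> [[/(tricrucialE (l := 2) _ m0 isT)[_ ndec [R L A]] En]|/mapP[j]].
  subst n; have [j jm ->] := tricrucial_shape m2 (perm_one_line s) ndec R L A.
  by apply: map_f; rewrite mem_iota; lia.
rewrite mem_iota => jm sE; split; first by apply: word_tricrucial sE; lia.
have /perm_size := perm_one_line s.
by rewrite sE (perm_size (word_perm j m0)) !size_iota.
Qed.

(** For k = 3, two words appear besides those of the general family. *)
Definition words3 := [seq word 2 j | j <- iota 1 2] ++
  [:: [:: 3; 1; 4; 2]; [:: 3; 4; 1; 2]].

(** The increasing triples of letters and their reversals are exactly the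
    patterns 123 and 321 in a word on 1, ..., 4; a check of the 24 words leaves
    four without them. *)
Lemma avoiding3 w : perm_eq w (iota 1 4) ->
  ~ contains ltn 3 w -> ~ contains gtn 3 w -> w \in words3.
Proof.
pose ts := [:: [:: 1; 2; 3]; [:: 1; 2; 4]; [:: 1; 3; 4]; [:: 2; 3; 4]].
move=> wP ninc ndec.
have /allP/(_ w) : all (fun v => [|| v \in words3, has (fun t => subseq t v) ts |
    has (fun t => subseq (rev t) v) ts]) (permutations (iota 1 4)).
  by vm_compute.
rewrite mem_permutations => /(_ wP) /or3P[//|/hasP[t tts tw]|/hasP[t tts tw]].
  by case: ninc; exists t; split=> //; move: tts; rewrite !inE => /or4P[] /eqP->.
by case: ndec; exists (rev t); split=> //; move: tts; rewrite !inE => /or4P[] /eqP->.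
Qed.

(** Both words have the descents 31 and 42 and the subwords 12 and 342: 12 and 42
    cross at 2, 34 and 31 cross at 3, and 342 is cut at its letter 4. *)
Lemma extra_tricrucial n (s : 'S_n) :
  one_line s \in [:: [:: 3; 1; 4; 2]; [:: 3; 4; 1; 2]] -> tricrucial 3 3 s.
Proof.
move=> sE; apply/tricrucialE => //; set w := one_line s in sE *.
have wP : perm_eq w (iota 1 4) by move: sE; rewrite !inE => /orP[] /eqP->.
have wU : uniq w by rewrite (perm_uniq wP) iota_uniq.
have sub u : u \in [:: [:: 3; 1]; [:: 4; 2]; [:: 1; 2]; [:: 3; 4; 2]] -> subseq u w.
  by move: sE; rewrite !inE => /orP[] /eqP-> /or4P[] /eqP->.
have b31 : before w 3 1 by have /andP[] := sorted_before wU (sub [:: 3; 1] isT).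
have b42 : before w 4 2 by have /andP[] := sorted_before wU (sub [:: 4; 2] isT).
have [p [pa pb]] := subseq_pivot (u1 := [:: 3]) (sub [:: 3; 4; 2] isT).
have pa' := subseq_trans pa (take_subseq _ _).
split; last split.
- apply: (no_long_increasing wP b31 _ b42) => // x.
  by rewrite (perm_mem wP) !inE; lia.
- case=> u [/subseqP[b sb ->]]; move: sb; rewrite (perm_size wP) /=.
  (* Each of the sixteen masks selects a subword of a concrete word. *)
  case: b => [|[] [|[] [|[] [|[] [|? ?]]]]] //;
    by move: sE; rewrite !inE => /orP[] /eqP->.
- by exists 2; split; [exists [:: 1; 2] | exists [:: 4; 2]];
    rewrite subseq_filter sub.
- exists 3; split; first by exists [:: 3; 4]; rewrite subseq_filter pa'.
  by exists [:: 3; 1]; rewrite subseq_filter sub.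
- by exists p; split; [exists [:: 3; 4] | exists [:: 4; 2]].
Qed.

Lemma minimal_tricrucial_3 n (s : 'S_n) :
  minimal_tricrucial 3 3 s <-> one_line s \in words3.
Proof.
rewrite minimal_tricrucialE //.
split=> [[/(tricrucialE (k := 2) (l := 2) _ isT isT)[ninc ndec _] En]|sE].
  by subst n; apply: avoiding3 (perm_one_line s) ninc ndec.
split.
  move: sE; rewrite mem_cat => /orP[/mapP[j]|/extra_tricrucial//].
  by rewrite mem_iota => jm; apply: word_tricrucial.
have /perm_size := perm_one_line s; rewrite size_iota => <-.
by move: sE; rewrite !inE => /or4P[] /eqP->.
Qed.

Theorem corollary33 :
  (forall k : nat, 3 < k -> num_minimal_tricrucial k 3 (k - 1)) /\
  num_minimal_tricrucial 3 3 4.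
Proof.
split=> [[//|m] m2|].
  have m0 : 0 < m by lia.
  have -> : m.+1 - 1 = size [seq word m j | j <- iota 1 m].
    by rewrite size_map size_iota subn1.
  apply: num_minimal_words; [exact: uniq_words | exact: words_perm_iota | ].
  by move=> n s; apply: minimal_tricrucial_gt3.
apply: (@num_minimal_words 3 3 words3) => //.
  by move=> w; rewrite !inE => /or4P[] /eqP->.
exact: minimal_tricrucial_3.
Qed.
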